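(* Let $n,d,C\ge 1$ be integers, let $y_1,\dots,y_n\in\{1,\dots,C\}$ be labels such that each class has at least two indices $i$ with that label, and let $\tau,\epsilon,\alpha,\beta>0$. Let $Z=[z_1,\dots,z_n]\in\mathbb{R}^{d\times n}$, let $F=[f_1,\dots,f_n]=-\nabla_Z\mathcal{J}(Z)$ where $\mathcal{J}$ is the leave-one-out objective, let $\kappa(z,z')=\exp(\tau z^\top z')$, and let $K=[\kappa(z_i,z_j)]_{i,j=1}^n+\epsilon I_n$. Let $\mathcal{I}$ be an index set, and on $\mathbb{R}^d\times\mathcal{I}$ let $$\widetilde\kappa((z,t),(z',t'))=\kappa(z,z')+\epsilon\,\mathbb{1}[t=t'].$$ Let the support points be $\bar z_i=(z_i,t_i)$, $i=1,\dots,n$, with distinct indices $t_1,\dots,t_n\in\mathcal{I}$, and let $\mathcal{H}_{\widetilde\kappa}^{d}$ be the product reproducing kernel Hilbert space of functions $g:\mathbb{R}^d\times\mathcal{I}\to\mathbb{R}^d$. Consider the problem $$\min_{g\in\mathcal{H}_{\widetilde\kappa}^{d}}\;-\sum_{i=1}^{n}\langle f_i,g(\bar z_i)\rangle+\frac{\beta}{2}\sum_{i=1}^{n}\lVert g(\bar z_i)\rVert_2^2+\frac{\alpha}{2}\lVert g\rVert_{\mathcal{H}_{\widetilde\kappa}^{d}}^2 .$$ Then its minimizer is $$g(\bar z)=\Gamma\,k_{\bar z},\qquad \Gamma=F(\beta K+\alpha I_n)^{-1},\qquad k_{\bar z}=[\widetilde\kappa(\bar z,\bar z_1),\dots,\widetilde\kappa(\bar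 z,\bar z_n)]^\top .$$ Consequently, (i) at any unseen query $\bar z_q=(z_q,t_q)$ with $t_q\notin\{t_1,\dots,t_n\}$, $$g(\bar z_q)=F(\beta K+\alpha I_n)^{-1}k_q,\qquad k_q=[\kappa(z_q,z_1),\dots,\kappa(z_q,z_n)]^\top;$$ and (ii) on the support points, $[g(\bar z_1),\dots,g(\bar z_n)]=\Gamma K=U^*$, where $U^*=FK(\beta K+\alpha I_n)^{-1}$.
   Context: For $Z=[z_1,\dots,z_n]\in\mathbb{R}^{d\times n}$ with columns $z_i\in\mathbb{R}^d$ and for $j\neq i$ define $$a_{ij}(Z)=\frac{\kappa(z_i,z_j)}{\sum_{k\ne i}\kappa(z_i,z_k)},\qquad q_i(Z)=\sum_{j\ne i}a_{ij}(Z)\,\mathbb{1}[y_j=y_i].$$ The leave-one-out objective is $\mathcal{J}(Z)=-\frac1n\sum_{i=1}^n\log q_i(Z)$, which is finite because every class has at least two rows; $\nabla_Z\mathcal{J}$ is its gradient with respect to the Frobenius inner product. $\mathcal{H}_{\widetilde\kappa}$ is the scalar reproducing kernel Hilbert space on $\mathbb{R}^d\times\mathcal{I}$ with kernel $\widetilde\kappa$, and the product space $\mathcal{H}_{\widetilde\kappa}^{d}$ consists of functions $g=(g^{(1)},\dots,g^{(d)})$ with each $g^{(m)}\in\mathcal{H}_{\widetilde\kappa}$ and norm $\lVert g\rVert_{\mathcal{H}_{\widetilde\kappa}^{d}}^2=\sum_{m=1}^d\lVert g^{(m)}\rVert_{\mathcal{H}_{\widetilde\kappa}}^2$. The distinct-index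 convention covers repeated feature vectors: the $z_i$ need not be distinct. $I_n$ is the $n\times n$ identity. *)

(* Defs.v *)
From HB Require Import structures.
From mathcomp Require Import all_boot all_order all_algebra.
From mathcomp Require Import all_classical all_reals all_analysis.
Import Order.TTheory GRing.Theory Num.Theory.
Import numFieldNormedType.Exports.

Set Implicit Arguments.
Unset Strict Implicit.
Unset Printing Implicit Defensive.

Local Open Scope classical_set_scope.
Local Open Scope ring_scope.

Section Euclidean.
Context {R : realType}.

Definition edot d (u v : 'cV[R]_d) : R := (u^T *m v) 0 0.

(* The library norm on matrices is the max norm, hence a separate notion. *)
Definition enorm d (u : 'cV[R]_d) : R := Num.sqrt (edot u u).

Definition frob_dot d n (A B : 'M[R]_(d, n)) : R := \tr (A^T *m B).

(* The matrix representing the differential for [frob_dot], see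
   [frob_gradientP]. *)
Definition frob_gradient d n (f : 'M[R]_(d, n) -> R) (Z : 'M[R]_(d, n)) :
  'M[R]_(d, n) := \matrix_(a, i) 'd f Z (delta_mx a i).

Lemma frob_gradientP d n (f : 'M[R]_(d, n) -> R) (Z V : 'M[R]_(d, n)) :
  differentiable f Z -> 'd f Z V = frob_dot (frob_gradient f Z) V.
Proof.
move=> df; rewrite {1}(matrix_sum_delta V) linear_sum /frob_dot /mxtrace.
under eq_bigr do rewrite linear_sum; rewrite exchange_big /=.
apply: eq_bigr => j _; rewrite mxE; apply: eq_bigr => i _.
by rewrite linearZ /= !mxE mulrC.
Qed.

End Euclidean.

Section LeaveOneOut.
Context {R : realType}.

Definition kappa (tau : R) d (z z' : 'cV[R]_d) : R := expR (tau * edot z z').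

Definition loo_weight (tau : R) d n (Z : 'M[R]_(d, n)) (i j : 'I_n) : R :=
  kappa tau (col i Z) (col j Z)
  / \sum_(k < n | k != i) kappa tau (col i Z) (col k Z).

Definition loo_prob (tau : R) d n C (y : 'I_n -> 'I_C) (Z : 'M[R]_(d, n))
    (i : 'I_n) : R :=
  \sum_(j < n | j != i) loo_weight tau Z i j * (y j == y i)%:R.

Definition loo_objective (tau : R) d n C (y : 'I_n -> 'I_C)
    (Z : 'M[R]_(d, n)) : R :=
  - (n%:R^-1 * \sum_(i < n) ln (loo_prob tau y Z i)).

Lemma kappa_differentiable (tau : R) d n (Z : 'M[R]_(d, n)) (i j : 'I_n) :
  differentiable (fun W : 'M[R]_(d, n) => kappa tau (col i W) (col j W)) Z.
Proof.
have -> : (fun W : 'M[R]_(d, n) => kappa tau (col i W) (col j W)) =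
    expR \o (tau \*: \sum_(a < d) ((fun W : 'M[R]_(d, n) => W a i) *
                                (fun W : 'M[R]_(d, n) => W a j))).
  apply/funext => W; rewrite /kappa /edot /= mxE fct_sumE; congr (expR (_ * _)).
  by apply: eq_bigr => a _; rewrite !mxE.
apply: differentiable_comp; last exact/derivable1_diffP/derivable_expR.
apply: differentiableZ; apply: differentiable_sum => a.
by apply: differentiableM; exact: differentiable_coord.
Qed.


Lemma loo_prob_gt0 (tau : R) d n C (y : 'I_n -> 'I_C) (Z : 'M[R]_(d, n)) i :
  (forall c : 'I_C, (1 < #|[set j | y j == c]%SET|)%N) -> 0 < loo_prob tau y Z i.
Proof.
move=> /(_ (y i)) /card_gt1P[j [k [+ + jk]]].
rewrite !inE => /eqP yj /eqP yk.
have [l li yl] : exists2 l, l != i & y l = y i.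
  by have [ji|ji] := eqVneq j i; [exists k => //; rewrite -ji eq_sym|exists j].
have den_gt0 : 0 < \sum_(k < n | k != i) kappa tau (col i Z) (col k Z).
  rewrite (bigD1 l li) /= ltr_pwDl ?expR_gt0// sumr_ge0// => m _.
  exact: expR_ge0.
rewrite /loo_prob (bigD1 l li) /= ltr_pwDl//.
  by rewrite yl eqxx mulr1 divr_gt0 ?expR_gt0.
by apply: sumr_ge0 => m _; rewrite mulr_ge0// divr_ge0 ?expR_ge0// ltW.
Qed.

Lemma loo_objective_differentiable (tau : R) d n C (y : 'I_n -> 'I_C)
    (Z : 'M[R]_(d, n)) :
  (forall c : 'I_C, (1 < #|[set j | y j == c]%SET|)%N) ->
  differentiable (loo_objective tau y) Z.
Proof.
move=> ycard.
have dsum (P : pred 'I_n) (f : 'I_n -> 'M[R]_(d, n) -> R) :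
    (forall i, P i -> differentiable (f i) Z) ->
    differentiable (fun W => \sum_(i < n | P i) f i W) Z.
  move=> df; have -> : (fun W => \sum_(i < n | P i) f i W) =
      \sum_(i < n) (if P i then f i else cst 0).
    apply/funext => W; rewrite fct_sumE big_mkcond.
    by apply: eq_bigr => i _; case: ifP.
  apply: differentiable_sum => i; case: ifPn => [/df//|_].
  exact: differentiable_cst.
have -> : loo_objective tau y = - (n%:R^-1 \*:
    (fun W : 'M[R]_(d, n) => \sum_(i < n) ln (loo_prob tau y W i))) by [].
apply/differentiableN/differentiableZ; apply: (dsum) => i _.
have qi_gt0 := loo_prob_gt0 tau Z i ycard.
apply: (@differentiable_comp _ _ _ _ (loo_prob tau y ^~ i) (@ln R)); last first.
  by apply/derivable1_diffP; apply: ex_derive; exact: is_derive1_ln.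
apply: (dsum) => j ji.
apply: (@differentiableM _ _ (fun W : 'M[R]_(d, n) => loo_weight tau W i j));
  last exact: differentiable_cst.
apply: differentiableM; first exact: kappa_differentiable.
apply: differentiableV.
  by apply: (dsum) => k _; exact: kappa_differentiable.
rewrite gt_eqF// (bigD1 j ji) /= ltr_pwDl ?expR_gt0// sumr_ge0// => k _.
exact: expR_ge0.
Qed.

End LeaveOneOut.

Section ReproducingKernel.
Context {R : realType}.

(* A reproducing kernel Hilbert space with kernel [k]: a set of functions that
   is a Hilbert space for [rk_dot], contains the kernel sections and has the
   reproducing property. By the Moore-Aronszajn theorem a positive semidefinite
   [k] determines the carrier and the inner product on it; the values of
   [rk_dot] outside the carrier are irrelevant. *)
Record rkhs (X : Type) (k : X -> X -> R) := Rkhs {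
  rk_carrier : set (X -> R) ;
  rk_dot : (X -> R) -> (X -> R) -> R ;
  rk_norm := fun f => Num.sqrt (rk_dot f f) ;
  rk_mem0 : rk_carrier (cst 0) ;
  rk_memP : forall a f g, rk_carrier f -> rk_carrier g ->
    rk_carrier (a \*o f \+ g) ;
  rk_dotC : forall f g, rk_carrier f -> rk_carrier g ->
    rk_dot f g = rk_dot g f ;
  rk_dotP : forall a f g h, rk_carrier f -> rk_carrier g -> rk_carrier h ->
    rk_dot (a \*o f \+ g) h = a * rk_dot f h + rk_dot g h ;
  rk_dot_ge0 : forall f, rk_carrier f -> 0 <= rk_dot f f ;
  rk_dot_eq0 : forall f, rk_carrier f -> rk_dot f f = 0 -> f = cst 0 ;
  rk_complete : forall u : nat -> X -> R, (forall m, rk_carrier (u m)) ->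
    (forall e, 0 < e -> exists N, forall m p, (N <= m)%N -> (N <= p)%N ->
      rk_norm (u m \- u p) < e) ->
    exists2 f, rk_carrier f & (fun m => rk_norm (u m \- f)) @ \oo --> 0 ;
  rk_kernel : forall x, rk_carrier (k^~ x) ;
  rk_repr : forall f x, rk_carrier f -> f x = rk_dot f (k^~ x) }.

Definition rk_coord X d (g : X -> 'cV[R]_d) (m : 'I_d) : X -> R :=
  fun x => g x m 0.

Definition rk_prod X (k : X -> X -> R) (H : rkhs k) d : set (X -> 'cV[R]_d) :=
  [set g | forall m, rk_carrier H (rk_coord g m)].

Definition rk_prod_norm X (k : X -> X -> R) (H : rkhs k) d
    (g : X -> 'cV[R]_d) : R :=
  Num.sqrt (\sum_(m < d) rk_norm H (rk_coord g m) ^+ 2).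

Definition lifted_kernel (tau eps : R) d (I : Type) (x x' : 'cV[R]_d * I) : R :=
  kappa tau x.1 x'.1 + eps * `[< x.2 = x'.2 >]%:R.

Definition fit_objective X (k : X -> X -> R) (H : rkhs k) d n
    (F : 'M[R]_(d, n)) (alpha beta : R) (x : 'I_n -> X)
    (g : X -> 'cV[R]_d) : R :=
  - (\sum_(i < n) edot (col i F) (g (x i)))
  + beta / 2 * (\sum_(i < n) enorm (g (x i)) ^+ 2)
  + alpha / 2 * rk_prod_norm H g ^+ 2.

Definition is_minimizer T (A : set T) (f : T -> R) (a : T) : Prop :=
  A a /\ forall b, A b -> f a <= f b.

End ReproducingKernel.

Arguments rk_prod {R X k} H d.

(* Main.v *)
Require Import Defs.
From HB Require Import structures.
From mathcomp Require Import all_boot all_order all_algebra.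
From mathcomp Require Import all_classical all_reals all_analysis.
From mathcomp Require Import ring lra.
Import Order.TTheory GRing.Theory Num.Theory.
Import numFieldNormedType.Exports.
Local Open Scope classical_set_scope.
Local Open Scope ring_scope.

Set Implicit Arguments.
Unset Strict Implicit.
Unset Printing Implicit Defensive.

(** The gradient matrix [F] enters only as a fixed matrix. Evaluations and norms
split over the [d] coordinates, so the objective is a sum of scalar quadratic
functionals on [H]. By the reproducing property the derivative of such a
functional at a combination [f] of the kernel sections at the support points, in
a direction [w], only sees the values of [w] at the support points; it vanishes
exactly when the coefficients solve the linear system with matrix
[beta *: K + alpha%:M]. Then [fit (f + w)] exceeds [fit f] by half of
[beta * \sum_i w (x i) ^+ 2 + alpha * rk_dot H w w], which gives minimality and
uniqueness at once. The matrix is invertible because [K] is the Gram matrix of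
the sections, hence positive semidefinite. *)

(** * Kernel expansions at the support points and scalar quadratic fits *)

Section KernelExpansion.
Context {R : realType} {X : Type} {k : X -> X -> R} (H : rkhs k).
Context {n : nat} (x : 'I_n -> X).

Definition gram : 'M[R]_n := \matrix_(i, j) k (x i) (x j).

Definition kexp (c : 'I_n -> R) : X -> R := fun z => \sum_(i < n) c i * k z (x i).

(** Both claims go through one induction on the list of indices, because linearity of [rk_dot] holds
    only on the carrier: splitting off a section requires the remaining sum to lie there. *)
Lemma rk_kexp_dot (c : 'I_n -> R) :
  rk_carrier H (kexp c) /\
  forall f, rk_carrier H f -> rk_dot H (kexp c) f = \sum_(i < n) c i * f (x i).
Proof.
rewrite /kexp; elim: (index_enum _) => [|i s [IHc IHd]].
  have -> : (fun z => \sum_(i <- [::]) c i * k z (x i)) = cst 0.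
    by apply/funext => z; rewrite big_nil.
  split=> [|f Hf]; first exact: rk_mem0.
  (* Linearity applied to 0 = 1 * 0 + 0 says that the product of 0 with [f] is twice itself, hence
     zero. *)
  have := rk_dotP 1 (rk_mem0 H) (rk_mem0 H) Hf.
  have -> : 1 \*o cst 0 \+ cst 0 = cst 0 :> (X -> R).
    by apply/funext => z /=; rewrite mulr0 addr0.
  by rewrite big_nil => e; lra.
have -> : (fun z => \sum_(j <- i :: s) c j * k z (x j)) =
    c i \*o k^~ (x i) \+ (fun z => \sum_(j <- s) c j * k z (x j)).
  by apply/funext => z; rewrite big_cons.
split=> [|f Hf]; first by apply: rk_memP => //; exact: rk_kernel.
rewrite (rk_dotP _ (rk_kernel H (x i)) IHc Hf) (IHd _ Hf) big_cons.
by rewrite (rk_dotC (rk_kernel H (x i)) Hf) -(rk_repr _ Hf).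
Qed.

Lemma rk_kexp c : rk_carrier H (kexp c).
Proof. by have [] := rk_kexp_dot c. Qed.

Lemma rk_dot_kexp c f : rk_carrier H f ->
  rk_dot H (kexp c) f = \sum_(i < n) c i * f (x i).
Proof. by have [_] := rk_kexp_dot c; exact. Qed.

(** The quadratic form is the squared norm of the expansion with coefficients [v]. *)
Lemma gram_psd (v : 'rV[R]_n) : 0 <= (v *m gram *m v^T) 0 0.
Proof.
have := rk_dot_ge0 (rk_kexp (v 0)); rewrite rk_dot_kexp; last exact: rk_kexp.
suff -> : \sum_(i < n) v 0 i * kexp (v 0) (x i) = (v *m gram *m v^T) 0 0 by [].
rewrite -mulmxA mxE; apply: eq_bigr => i _; rewrite mxE; congr (_ * _).
by apply: eq_bigr => j _; rewrite !mxE mulrC.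
Qed.

Lemma gram_regularized_unit (alpha beta : R) : 0 < alpha -> 0 <= beta ->
  beta *: gram + alpha%:M \in unitmx.
Proof.
move=> a0 b0; rewrite -row_free_unit; apply: inj_row_free => v vA0.
have : (v *m (beta *: gram + alpha%:M) *m v^T) 0 0 = 0 by rewrite vA0 mul0mx mxE.
rewrite mulmxDr mulmxDl -scalemxAr -scalemxAl mul_mx_scalar -scalemxAl.
rewrite [LHS]mxE [X in X + _]mxE [X in _ + X]mxE.
have G0 := mulr_ge0 b0 (gram_psd v).
have vv : (v *m v^T) 0 0 = \sum_i v 0 i ^+ 2.
  by rewrite mxE; apply: eq_bigr => i _; rewrite mxE expr2.
have v0 : 0 <= \sum_i v 0 i ^+ 2 by apply: sumr_ge0 => i _; exact: sqr_ge0.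
rewrite vv => e0.
have /eqP : \sum_i v 0 i ^+ 2 = 0.
  (* A nonnegative Gram term plus [alpha] times the sum of squares is zero, so that sum cannot be
     positive. *)
  by apply/eqP; rewrite eq_le v0 andbT -(pmulr_rle0 _ a0); lra.
rewrite psumr_eq0 => [/allP s0|i _]; last exact: sqr_ge0.
apply/rowP => i; rewrite mxE; apply/eqP.
by have := s0 i (mem_index_enum i); rewrite /= sqrf_eq0.
Qed.

Definition scalar_fit (F : 'I_n -> R) (alpha beta : R) (f : X -> R) : R :=
  - (\sum_(i < n) F i * f (x i)) + beta / 2 * (\sum_(i < n) f (x i) ^+ 2)
  + alpha / 2 * rk_dot H f f.

Lemma rk_memB f h : rk_carrier H f -> rk_carrier H h -> rk_carrier H (h \- f).
Proof.
move=> Hf Hh; have -> : h \- f = (-1) \*o f \+ h.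
  by apply/funext => z /=; rewrite mulN1r addrC.
exact: rk_memP.
Qed.

Lemma rk_dotD_sqr f w : rk_carrier H f -> rk_carrier H w ->
  rk_dot H (f \+ w) (f \+ w) = rk_dot H f f + 2 * rk_dot H f w + rk_dot H w w.
Proof.
move=> Hf Hw; have E : f \+ w = 1 \*o f \+ w by apply/funext => z /=; rewrite mul1r.
have Hs : rk_carrier H (f \+ w) by rewrite E; exact: rk_memP.
rewrite {1}E (rk_dotP _ Hf Hw Hs) (rk_dotC Hf Hs) (rk_dotC Hw Hs) E.
rewrite !(rk_dotP _ Hf Hw) // (rk_dotC Hw Hf); ring.
Qed.

(* The hypothesis on [c] is the vanishing of the first variation. *)
Lemma scalar_fit_excess (F c : 'I_n -> R) alpha beta h :
  (forall i, beta * kexp c (x i) + alpha * c i = F i) -> rk_carrier H h ->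
  scalar_fit F alpha beta h = scalar_fit F alpha beta (kexp c)
    + (beta / 2 * (\sum_(i < n) (h \- kexp c) (x i) ^+ 2)
       + alpha / 2 * rk_dot H (h \- kexp c) (h \- kexp c)).
Proof.
move=> cF Hh; set f := kexp c; set w := h \- f.
have Hf : rk_carrier H f := rk_kexp c.
have Hw : rk_carrier H w := rk_memB Hf Hh.
have -> : h = f \+ w by apply/funext => z /=; rewrite /w /= addrC subrK.
rewrite /scalar_fit (rk_dotD_sqr Hf Hw) (rk_dot_kexp c Hw).
(* Stationarity splits the part linear in [w] into exactly the cross terms of the two quadratic
   penalties, which therefore cancel. *)
have -> : \sum_(i < n) F i * (f \+ w) (x i) = \sum_(i < n) F i * f (x i)
    + beta * (\sum_(i < n) f (x i) * w (x i)) + alpha * \sum_(i < n) c i * w (x i).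
  rewrite !mulr_sumr -!big_split; apply: eq_bigr => i _ /=.
  by rewrite -cF -/f; ring.
have -> : \sum_(i < n) (f \+ w) (x i) ^+ 2 = \sum_(i < n) f (x i) ^+ 2
    + 2 * (\sum_(i < n) f (x i) * w (x i)) + \sum_(i < n) w (x i) ^+ 2.
  rewrite !mulr_sumr -!big_split; apply: eq_bigr => i _ /=; ring.
by field.
Qed.

End KernelExpansion.

(** * Reduction of the vector-valued fit to its coordinates *)

Section VectorValuedFit.
Context {R : realType} {X : Type} {k : X -> X -> R} (H : rkhs k).
Context {d n : nat} (x : 'I_n -> X) (F : 'M[R]_(d, n)) (alpha beta : R).

Lemma edotE (u v : 'cV[R]_d) : edot u v = \sum_(m < d) u m 0 * v m 0.
Proof. by rewrite /edot mxE; apply: eq_bigr => m _; rewrite mxE. Qed.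

Lemma sqr_enorm (u : 'cV[R]_d) : enorm u ^+ 2 = \sum_(m < d) u m 0 ^+ 2.
Proof.
have e : edot u u = \sum_(m < d) u m 0 ^+ 2.
  by rewrite edotE; apply: eq_bigr => m _; rewrite expr2.
by rewrite /enorm sqr_sqrtr e // sumr_ge0 // => m _; exact: sqr_ge0.
Qed.

Lemma sqr_rk_prod_norm (h : X -> 'cV[R]_d) : rk_prod H d h ->
  rk_prod_norm H h ^+ 2 = \sum_(m < d) rk_dot H (rk_coord h m) (rk_coord h m).
Proof.
move=> Hh; rewrite /rk_prod_norm sqr_sqrtr; last first.
  by apply: sumr_ge0 => m _; exact: sqr_ge0.
by apply: eq_bigr => m _; rewrite sqr_sqrtr //; exact/rk_dot_ge0/Hh.
Qed.

Lemma fit_objectiveE (h : X -> 'cV[R]_d) : rk_prod H d h ->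
  fit_objective H F alpha beta x h =
  \sum_(m < d) scalar_fit H x (F m) alpha beta (rk_coord h m).
Proof.
move=> Hh; rewrite /fit_objective sqr_rk_prod_norm // /scalar_fit !big_split /=.
rewrite sumrN -!mulr_sumr; congr (- _ + _ * _ + _).
  rewrite [RHS]exchange_big; apply: eq_bigr => i _; rewrite edotE.
  by apply: eq_bigr => m _; rewrite mxE.
by rewrite [RHS]exchange_big; apply: eq_bigr => i _; rewrite sqr_enorm.
Qed.

Definition representer (Gamma : 'M[R]_(d, n)) (z : X) : 'cV[R]_d :=
  Gamma *m \col_(i < n) k z (x i).

Lemma rk_coord_representer Gamma m :
  rk_coord (representer Gamma) m = kexp (k := k) x (Gamma m).
Proof.
by apply/funext => z; rewrite /rk_coord mxE; apply: eq_bigr => i _; rewrite mxE.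
Qed.

Lemma representer_minimizer (Gamma : 'M[R]_(d, n)) : 0 < alpha -> 0 <= beta ->
  Gamma *m (beta *: gram (k := k) x + alpha%:M) = F ->
  is_minimizer (rk_prod H d) (fit_objective H F alpha beta x) (representer Gamma)
  /\ forall h, is_minimizer (rk_prod H d) (fit_objective H F alpha beta x) h ->
       h = representer Gamma.
Proof.
move=> a0 b0 GF; set g := representer Gamma.
have Hg : rk_prod H d g by move=> m; rewrite rk_coord_representer; exact: rk_kexp.
(* Symmetry of the kernel comes from reproducing one section against another; [stat] uses it because
   the matrix product transposes the arguments found in [kexp]. *)
have ksym u v : k u v = k v u.
  rewrite (rk_repr u (rk_kernel H v)) (rk_repr v (rk_kernel H u)).
  by apply: rk_dotC; exact: rk_kernel.
have stat m i : beta * kexp (k := k) x (Gamma m) (x i) + alpha * Gamma m i = F m i.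
  rewrite -GF mulmxDr -scalemxAr mul_mx_scalar !mxE; congr (_ * _ + _).
  by apply: eq_bigr => j _; rewrite mxE ksym.
pose gap (h : X -> 'cV[R]_d) m := rk_coord h m \- rk_coord g m.
have Hgap h m : rk_prod H d h -> rk_carrier H (gap h m).
  by move=> Hh; exact: rk_memB.
(* The [beta] part of the excess is nonnegative and is dropped; the [alpha] part is kept since it
   controls the full norm of the gap. *)
have excess h : rk_prod H d h -> fit_objective H F alpha beta x g
    + alpha / 2 * (\sum_(m < d) rk_dot H (gap h m) (gap h m))
    <= fit_objective H F alpha beta x h.
  move=> Hh; rewrite !fit_objectiveE // mulr_sumr -big_split /=.
  apply: ler_sum => m _; rewrite (scalar_fit_excess (stat m) (Hh m)).
  rewrite /gap /g rk_coord_representer lerD2l lerDr mulr_ge0 ?divr_ge0 //.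
  by apply: sumr_ge0 => i _; exact: sqr_ge0.
have dot0 h m : rk_prod H d h -> 0 <= rk_dot H (gap h m) (gap h m).
  by move=> Hh; exact/rk_dot_ge0/Hgap.
have a20 : 0 < alpha / 2 by rewrite divr_gt0.
split=> [|h [Hh hmin]].
  split=> // h Hh; apply: le_trans (excess h Hh); rewrite lerDl.
  by rewrite mulr_ge0 ?(ltW a20) // sumr_ge0 // => m _; exact: dot0.
have := le_trans (excess h Hh) (hmin g Hg); rewrite gerDl pmulr_rle0 // => le0.
have /eqP : \sum_(m < d) rk_dot H (gap h m) (gap h m) = 0.
  by apply/eqP; rewrite eq_le le0 sumr_ge0 // => m _; exact: dot0.
rewrite psumr_eq0 => [/allP s0|m _]; last exact: dot0.
apply/funext => z; apply/colP => m.
(* A gap of norm zero is the zero function, so [h] and [g] agree at every point and not only on the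
   support. *)
have /eqP /(rk_dot_eq0 (Hgap _ m Hh)) gap0 := s0 m (mem_index_enum m).
have /eqP : gap h m z = 0 by rewrite gap0.
by rewrite /gap /= subr_eq0 => /eqP.
Qed.

End VectorValuedFit.

(** * Specialization to the lifted kernel and the leave-one-out gradient *)

Theorem mainTheorem2 (R : realType) (n d C : nat) (y : 'I_n -> 'I_C)
    (tau eps alpha beta : R) (Z : 'M[R]_(d, n))
    (I : Type) (t : 'I_n -> I)
    (H : rkhs (@lifted_kernel R tau eps d I)) :
  (0 < n)%N -> (0 < d)%N -> (0 < C)%N ->
  (forall c : 'I_C, (1 < #|[set i : 'I_n | y i == c]%SET|)%N) ->
  0 < tau -> 0 < eps -> 0 < alpha -> 0 < beta ->
  injective t ->
  let F : 'M[R]_(d, n) := - frob_gradient (loo_objective tau y) Z in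
  let K : 'M[R]_n :=
    (\matrix_(i, j) kappa tau (col i Z) (col j Z)) + eps%:M in
  let zbar (i : 'I_n) : 'cV[R]_d * I := (col i Z, t i) in
  let Gamma : 'M[R]_(d, n) := F *m invmx (beta *: K + alpha%:M) in
  let g (x : 'cV[R]_d * I) : 'cV[R]_d :=
    Gamma *m \col_(i < n) lifted_kernel tau eps x (zbar i) in
  let Ustar : 'M[R]_(d, n) := F *m K *m invmx (beta *: K + alpha%:M) in
  [/\ beta *: K + alpha%:M \in unitmx,
      is_minimizer (rk_prod H d) (fit_objective H F alpha beta zbar) g
      /\ (forall h,
            is_minimizer (rk_prod H d) (fit_objective H F alpha beta zbar) h ->
            h = g),
      forall (zq : 'cV[R]_d) (tq : I), (forall i, tq <> t i) ->
        g (zq, tq) = F *m invmx (beta *: K + alpha%:M)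
                       *m \col_(i < n) kappa tau zq (col i Z)
    & \matrix_(m < d, i < n) g (zbar i) m 0 = Gamma *m K
      /\ Gamma *m K = Ustar].
Proof.
move=> _ _ _ _ _ _ a0 b0 tinj F K zbar Gamma g Ustar.
(* Distinct indices turn the indicator part of the kernel into the identity matrix, even when
   columns of [Z] repeat. *)
have KE : K = gram (k := @lifted_kernel R tau eps d I) zbar.
  apply/matrixP => i j; rewrite !mxE /lifted_kernel /= mulr_natr.
  congr (_ + _ *+ nat_of_bool _); apply/esym.
  by apply/asboolP/eqP => [/tinj|->].
have Au : beta *: K + alpha%:M \in unitmx.
  by rewrite KE; exact: (gram_regularized_unit H zbar a0 (ltW b0)).
split=> //.
- by apply: representer_minimizer (ltW b0) _ => //; rewrite -KE /Gamma mulmxKV.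
- move=> zq tq tqt; rewrite /g /Gamma; congr (_ *m _); apply/colP => i.
  by rewrite !mxE /lifted_kernel /= asboolF ?mulr0 ?addr0 //; exact: tqt.
split.
  (* The two sides evaluate the kernel with its arguments swapped; they agree by symmetry of the dot
     product and of index equality. *)
  rewrite KE; apply/matrixP => m i; rewrite mxE /g mxE [RHS]mxE.
  apply: eq_bigr => j _; rewrite !mxE /lifted_kernel /kappa /edot /=.
  congr (_ * (expR (_ * _) + _ * _%:R)).
    by rewrite !mxE; apply: eq_bigr => a _; rewrite !mxE mulrC.
  by congr nat_of_bool; apply/asboolP/asboolP => ->.
(* Since [K] commutes with this matrix it commutes with its inverse, which moves the inverse to the
   right of [K]. *)
have AK : (beta *: K + alpha%:M) *m K = K *m (beta *: K + alpha%:M).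
  by rewrite mulmxDl [RHS]mulmxDr -scalemxAl -scalemxAr scalar_mxC.
rewrite /Gamma /Ustar -!mulmxA; congr (F *m _).
by rewrite -[LHS](mulmxK Au) -(mulmxA (invmx _)) -AK (mulmxA (invmx _)) mulVmx // mul1mx.
Qed.
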